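(* Let $C,C_1,D,D_1$ be at most countable sets and let $$u\in\Delta\bigl(K\times(C\times C_1)\times(D\times D_1)\bigr),\quad v=\mathrm{marg}_{K\times C\times(D\times D_1)}u,\quad u'=\mathrm{marg}_{K\times(C\times C_1)\times D}u,\quad v'=\mathrm{marg}_{K\times C\times D}u.$$ Suppose that, under $u$, $(c,c_1)$ and $d$ are conditionally independent given $k$. Then $$d(u',v')\le d(u,v).$$
   Context: $K$ is a finite set with $|K|\ge2$. An information structure is a probability on $K\times S_1\times S_2$ with $S_1,S_2$ at most countable, where $k\in K$ is the state and $S_i$ is the set of signals of player $i$. In $u$, player 1's signal is $(c,c_1)\in C\times C_1$ and player 2's signal is $(d,d_1)\in D\times D_1$; in $v$ the signals are $c$ and $(d,d_1)$; in $u'$ they are $(c,c_1)$ and $d$; in $v'$ they are $c$ and $d$. $\mathrm{marg}$ denotes the marginal distribution. A payoff function is a map $g:K\times I\times J\to[-1,1]$ with $I,J$ nonempty finite sets; $\mathcal{G}$ is the set of all payoff functions. In the zero-sum Bayesian game $\Gamma(u,g)$, $(k,s_1,s_2)$ is drawn from $u$, player $i$ learns $s_i$, they simultaneously choose $i\in I$ and $j\in J$, and player 1 (the maximizer) receives $g(k,i,j)$ from player 2; $\mathrm{val}(u,g)$ is its value in mixed strategies. The value-based distance is $d(u,v)=\sup_{g\in\mathcal{G}}|\mathrm{val}(u,g)-\mathrm{val}(v,g)|$. *)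

(* Defs.v *)
From HB Require Import structures.
From mathcomp Require Import all_boot all_order all_algebra.
From mathcomp Require Import all_classical all_reals.
From mathcomp Require Import ereal numfun esum.

Set Implicit Arguments.
Unset Strict Implicit.
Unset Printing Implicit Defensive.

Import Order.TTheory GRing.Theory Num.Theory.

Local Open Scope classical_set_scope.
Local Open Scope ring_scope.

Section discrete_probability.
Context {R : realType}.

(* Discrete probabilities on an at most countable type are given by their mass
   functions. *)
Definition is_distr {T : countType} (p : T -> R) : Prop :=
  (forall x, 0 <= p x) /\ \esum_(x in [set: T]) (p x)%:E = 1%E.

Definition prob {T : countType} (p : T -> R) (A : set T) : R :=
  fine (\esum_(x in A) (p x)%:E).

Definition cprob {T : countType} (p : T -> R) (A B : set T) : R :=
  prob p (A `&` B) / prob p B.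

(* esum is only meaningful for nonnegative summands, hence the decomposition
   into positive and negative parts. *)
Definition dexpectation {T : countType} (p : T -> R) (f : T -> R) : R :=
  let h : T -> \bar R := fun x => (p x * f x)%:E in
  fine (\esum_(x in [set: T]) (h^\+)%E x) - fine (\esum_(x in [set: T]) (h^\-)%E x).

(* Law of the random variable f; a marginal is the law of a projection. *)
Definition law {T T' : countType} (p : T -> R) (f : T -> T') : T' -> R :=
  fun y => prob p (f @^-1` [set y]).

Definition cond_indep {T A B Z : countType} (p : T -> R)
    (X : T -> A) (Y : T -> B) (W : T -> Z) : Prop :=
  forall (x : A) (y : B) (w : Z), 0 < prob p (W @^-1` [set w]) ->
    cprob p (X @^-1` [set x] `&` Y @^-1` [set y]) (W @^-1` [set w]) =
    cprob p (X @^-1` [set x]) (W @^-1` [set w]) *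
    cprob p (Y @^-1` [set y]) (W @^-1` [set w]).

End discrete_probability.

Section bayesian_game.
Context {R : realType}.

Definition is_mixed {I : finType} (x : I -> R) : Prop :=
  (forall i, 0 <= x i) /\ \sum_(i : I) x i = 1.

Definition strategy (S : countType) (I : finType) : set (S -> I -> R) :=
  [set sigma | forall s, is_mixed (sigma s)].
Arguments strategy S I : clear implicits.

Definition is_payoff {K I J : finType} (g : K -> I -> J -> R) : Prop :=
  [/\ (0 < #|I|)%N, (0 < #|J|)%N & forall k i j, -1 <= g k i j <= 1].

Context {K : finType} {S1 S2 : countType}.
Implicit Types u v : K * S1 * S2 -> R.

Definition payoff u {I J : finType} (g : K -> I -> J -> R)
    (sigma : S1 -> I -> R) (tau : S2 -> J -> R) : R :=
  dexpectation u (fun x => let: (k, s1, s2) := x in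
    \sum_(i : I) \sum_(j : J) sigma s1 i * tau s2 j * g k i j).

Definition maxmin u {I J : finType} (g : K -> I -> J -> R) : R :=
  sup [set inf [set payoff u g sigma tau | tau in strategy S2 J]
      | sigma in strategy S1 I].

Definition minmax u {I J : finType} (g : K -> I -> J -> R) : R :=
  inf [set sup [set payoff u g sigma tau | sigma in strategy S1 I]
      | tau in strategy S2 J].

Definition is_value u {I J : finType} (g : K -> I -> J -> R) (x : R) : Prop :=
  maxmin u g = x /\ minmax u g = x.

(* The value exists for every information structure u and payoff function g by
   the minmax theorem, so the default 0 of xget is irrelevant there. *)
Definition game_value u {I J : finType} (g : K -> I -> J -> R) : R :=
  xget 0 [set x | is_value u g x].

End bayesian_game.

Arguments strategy {R} S I _.

(* The two information structures may have different signal sets.  The set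
   below is nonempty and bounded by 2, so that sup is the genuine supremum. *)
Definition value_dist {R : realType} {K : finType} {S1 S2 T1 T2 : countType}
    (u : K * S1 * S2 -> R) (v : K * T1 * T2 -> R) : R :=
  sup [set r : R | exists (I J : finType) (g : K -> I -> J -> R),
    is_payoff g /\ r = `|game_value u g - game_value v g|].

(* Main.v *)
Require Import Defs.
From mathcomp Require Import all_boot all_order all_algebra.
From mathcomp Require Import all_classical all_reals.
From mathcomp Require Import ereal numfun esum.
From mathcomp Require Import ring lra.

(** Write [X] for player 1's signal (c, c1), [Y] for d and [W] for the state.

    In [u'] player 1 knows more than in [v'], so val(v', g) <= val(u', g) for
    every game [g]. Let [t] be a nearly optimal strategy of player 2 in [v'].
    Since [X] and [Y] are conditionally independent given the state, once
    player 2 uses [t] the payoff of any strategy of player 1 is its payoff in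
    the decision problem [h] in which g(k, i, .) is averaged over the
    conditional law of player 2's action given the state k
    ([averaged_payoffE]). This holds whether player 1 sees (c, c1) or only c.
    Consequently val(u', g) <= val(u, h), because [t] is one of player 2's
    strategies in [u'], and val(v, h) <= val(v', g) up to an arbitrarily small
    error, because [t] is nearly optimal in [v']. Hence
    val(u', g) - val(v', g) <= val(u, h) - val(v, h) <= d(u, v).

    The values are only meaningful once a minmax theorem is available for
    countably many signals ([maxmin_eq_minmax]). It is obtained from
    approximate saddle points: a finite set of signals carries almost all of
    the mass ([dexpectation_approx]), and for finitely many signals the
    time averages of two players who both use regret matching at each of
    their signals form an approximate saddle point ([finite_minimax]). This
    needs neither compactness nor linear programming duality.

    Expectations of bounded functions on a countable set are handled through
    linearity, change of variables ([dexpectation_law]) and the product rule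
    under conditional independence ([cond_indep_dexpectation]). *)

Set Implicit Arguments.
Unset Strict Implicit.
Unset Printing Implicit Defensive.

Import Order.TTheory GRing.Theory Num.Theory.

Local Open Scope classical_set_scope.
Local Open Scope ring_scope.

(** * Bounded functions *)

Section bounded.
Context {R : realType} {T : Type}.
Implicit Types f g : T -> R.

Definition bdd f := exists M, forall x, `|f x| <= M.

Lemma bdd_cst (c : R) : bdd (fun=> c).
Proof. by exists `|c|. Qed.

Lemma bddD f g : bdd f -> bdd g -> bdd (fun x => f x + g x).
Proof.
move=> [M fM] [N gN]; exists (M + N) => x.
by rewrite (le_trans (ler_normD _ _))// lerD.
Qed.

Lemma bddN f : bdd f -> bdd (fun x => - f x).
Proof. by move=> [M fM]; exists M => x; rewrite normrN. Qed.

Lemma bddM f g : bdd f -> bdd g -> bdd (fun x => f x * g x).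
Proof. by move=> [M fM] [N gN]; exists (M * N) => x; rewrite normrM ler_pM. Qed.

Lemma bdd_sum (I : Type) (r : seq I) (F : I -> T -> R) :
  (forall i, bdd (F i)) -> bdd (fun x => \sum_(i <- r) F i x).
Proof.
move=> bF; elim: r => [|i r [M IH]].
  by exists 0 => x; rewrite big_nil normr0.
have [N FN] := bF i; exists (N + M) => x; rewrite big_cons.
by rewrite (le_trans (ler_normD _ _))// lerD.
Qed.

Lemma bdd_ind (P : pred T) : bdd (fun x => (P x)%:R).
Proof. by exists 1 => x; case: (P x); rewrite ?normr1 ?normr0. Qed.

Lemma bdd_le01 f : (forall x, 0 <= f x <= 1) -> bdd f.
Proof.
by move=> f01; exists 1 => x; case/andP: (f01 x) => ? ?; rewrite ger0_norm.
Qed.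

End bounded.

Lemma bdd_comp {R : realType} {T U : Type} (f : U -> R) (phi : T -> U) :
  bdd f -> bdd (fun x => f (phi x)).
Proof. by move=> [M fM]; exists M => x. Qed.

(** * Linearity of expectation *)

Lemma esumZl {R : realType} {T : choiceType} (A : set T) (c : R)
    (f : T -> R) : 0 <= c -> (forall x, 0 <= f x) ->
  (\esum_(x in A) (c * f x)%:E = c%:E * \esum_(x in A) (f x)%:E)%E.
Proof.
(* One inequality, applied to [c] and to its inverse, gives the equality. *)
have half (d : R) (h : T -> R) : 0 <= d -> (forall x, 0 <= h x) ->
  (\esum_(x in A) (d * h x)%:E <= d%:E * \esum_(x in A) (h x)%:E)%E.
  move=> d0 h0; apply: ge_ereal_sup => /= _ [X XA <-].
  rewrite (eq_fsbigr (fun x => d%:E * (h x)%:E)%E)//.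
  rewrite -ge0_mule_fsumr//; apply: lee_wpmul2l; rewrite ?lee_fin//.
  by apply: esum_ge; exists X.
rewrite le_eqVlt => /predU1P[<- f0|c0 f0].
  by rewrite mul0e esum1// => x _; rewrite mul0r.
apply/eqP; rewrite eq_le half ?(ltW c0)//=.
have ci0 : 0 <= c^-1 by rewrite invr_ge0 ltW.
have := half c^-1 (fun x => c * f x) ci0 (fun x => mulr_ge0 (ltW c0) (f0 x)).
rewrite (eq_esum (b := fun x => (f x)%:E)); last first.
  by move=> x _; rewrite mulKf ?gt_eqF.
move=> /(lee_wpmul2l (x := c%:E)); rewrite lee_fin => /(_ (ltW c0)).
by rewrite muleA -EFinM mulfV ?gt_eqF// mul1e.
Qed.

Section expectation.
Context {R : realType} {T : countType}.
Implicit Types (p : T -> R) (f a b : T -> R).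

(** Conditioning on an event produces mass functions of total mass below one,
    so the expectation calculus is developed for any finite total mass. *)
Definition is_mass p :=
  (forall x, 0 <= p x) /\ \esum_(x in [set: T]) (p x)%:E \is a fin_num.

Lemma distr_mass p : is_distr p -> is_mass p.
Proof. by move=> [p0 p1]; split=> //; rewrite p1. Qed.

(** For nonnegative [f] this avoids the split into positive and negative
    parts; [dexpectationB] reduces the general case to it. *)
Definition nnexp p f := fine (\esum_(x in [set: T]) (p x * f x)%:E).

(** This finiteness is what allows passing from sums in the extended reals to
    their real values. *)
Lemma esum_mass p (A : set T) f : is_mass p -> bdd f -> (forall x, 0 <= f x) ->
  \esum_(x in A) (p x * f x)%:E \is a fin_num.
Proof.
move=> [p0 pfin] [M fM] f0; rewrite ge0_fin_numE; last first.
  by apply: esum_ge0 => x _; rewrite lee_fin mulr_ge0.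
apply: (@le_lt_trans _ _ (M%:E * \esum_(x in [set: T]) (p x)%:E)%E); last first.
  by rewrite -(fineK pfin) -EFinM ltry.
have M0 : forall x : T, 0 <= M by move=> x; rewrite (le_trans _ (fM x)).
rewrite esum_mkcond.
have [[x0 _]|T0] := pselect (exists x : T, True); last first.
  rewrite !esum1 ?mule0// => x; exfalso; by apply: T0; exists x.
rewrite -esumZl ?M0//; apply: le_esum => x _.
case: ifP => _; rewrite lee_fin; last by rewrite mulr_ge0 ?M0.
rewrite mulrC ler_wpM2r// (le_trans _ (fM x))// ger0_norm//.
Qed.

Lemma nnexp_ge0 p f :
  (forall x, 0 <= p x) -> (forall x, 0 <= f x) -> 0 <= nnexp p f.
Proof.
by move=> p0 f0; apply/fine_ge0/esum_ge0 => x _; rewrite lee_fin mulr_ge0.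
Qed.

(** Any decomposition into bounded nonnegative functions computes the
    expectation, not only the canonical one; linearity follows because
    such decompositions can be added. *)
Lemma dexpectationB p a b : is_mass p ->
  bdd a -> (forall x, 0 <= a x) -> bdd b -> (forall x, 0 <= b x) ->
  dexpectation p (fun x => a x - b x) = nnexp p a - nnexp p b.
Proof.
move=> mp ba a0 bb b0; have [p0 pfin] := mp.
have sm f : bdd f -> (forall x, 0 <= f x) ->
    summable [set: T] (fun x => (p x * f x)%:E).
  move=> bf f0; rewrite summableE.
  under eq_esum do rewrite gee0_abs ?lee_fin ?mulr_ge0//.
  exact: esum_mass.
have := @esumB R T setT _ _ (sm a ba a0) (sm b bb b0).
have eqh : ((fun x => (p x * a x)%:E) \- (fun x => (p x * b x)%:E))%E =
   (fun x => (p x * (a x - b x))%:E).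
  by apply/funext => x /=; rewrite -EFinB mulrBr.
rewrite eqh => H; rewrite /dexpectation /nnexp.
have sab : summable [set: T] (fun x => (p x * (a x - b x))%:E).
  by rewrite -eqh; apply: summableB; exact: sm.
rewrite -!fineB ?esum_mass//.
- rewrite H// => x _; by rewrite lee_fin mulr_ge0.
- have := summable_funepos sab; rewrite summableE.
  by under eq_esum do rewrite gee0_abs//.
- have := summable_funeneg sab; rewrite summableE.
  by under eq_esum do rewrite gee0_abs//.
Qed.

Lemma dexpectation_ge0E p f : is_mass p -> bdd f -> (forall x, 0 <= f x) ->
  dexpectation p f = nnexp p f.
Proof.
move=> mp bf f0; have := dexpectationB mp bf f0 (bdd_cst 0) (fun=> lexx 0).
rewrite (_ : nnexp p (fun=> 0) = 0); last first.
  by rewrite /nnexp esum1// => x _; rewrite mulr0.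
rewrite subr0 => <-; by congr dexpectation; apply/funext => x; rewrite subr0.
Qed.

Lemma bdd_posneg f : bdd f -> exists a b,
  [/\ bdd a, forall x, 0 <= a x, bdd b, forall x, 0 <= b x &
     f = (fun x => a x - b x)].
Proof.
move=> [M fM]; exists (fun x => f x + M), (fun=> M).
have M0 (x : T) : 0 <= M by rewrite (le_trans _ (fM x)).
split=> //; try exact: bdd_cst.
- by apply: bddD; [exists M|exact: bdd_cst].
- move=> x; have := fM x; rewrite ler_norml => /andP[].
  by rewrite -subr_ge0 opprK.
- by apply/funext => x; rewrite addrK.
Qed.

Lemma nnexpD p a b : is_mass p ->
  bdd a -> (forall x, 0 <= a x) -> bdd b -> (forall x, 0 <= b x) ->
  nnexp p (fun x => a x + b x) = nnexp p a + nnexp p b.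
Proof.
move=> mp ba a0 bb b0; have [p0 _] := mp.
rewrite /nnexp -fineD ?esum_mass//; congr fine.
rewrite -esumD => [|x _|x _]; rewrite ?lee_fin ?mulr_ge0//.
by apply: eq_esum => x _; rewrite -EFinD mulrDr.
Qed.

Lemma dexpectationD p f g : is_mass p -> bdd f -> bdd g ->
  dexpectation p (fun x => f x + g x) = dexpectation p f + dexpectation p g.
Proof.
move=> mp /bdd_posneg[a [b [ba a0 bb b0 ->]]].
move=> /bdd_posneg[c [d [bc c0 bd d0 ->]]].
rewrite !dexpectationB//.
transitivity (dexpectation p (fun x => (a x + c x) - (b x + d x))).
  by congr dexpectation; apply/funext => x; rewrite opprD addrACA.
rewrite dexpectationB ?nnexpD//; first ring.
- exact: bddD.
- by move=> x; rewrite addr_ge0.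
- exact: bddD.
- by move=> x; rewrite addr_ge0.
Qed.

Lemma dexpectation0 p : dexpectation p (fun=> 0) = 0.
Proof.
rewrite /dexpectation !esum1 ?subrr// => x _.
  by rewrite funenegE mulr0 oppe0 maxxx.
by rewrite funeposE mulr0 maxxx.
Qed.

Lemma nnexpZ p c f : is_mass p -> bdd f -> 0 <= c -> (forall x, 0 <= f x) ->
  nnexp p (fun x => c * f x) = c * nnexp p f.
Proof.
move=> mp bf c0 f0; rewrite /nnexp; have [p0 _] := mp.
under eq_esum do rewrite mulrCA.
rewrite esumZl//; last by move=> x; rewrite mulr_ge0.
by rewrite fineM// esum_mass.
Qed.

Lemma dexpectationN p f : is_mass p -> bdd f ->
  dexpectation p (fun x => - f x) = - dexpectation p f.
Proof.
move=> mp /bdd_posneg[a [b [ba a0 bb b0 ->]]].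
rewrite dexpectationB// opprB -dexpectationB//.
by congr dexpectation; apply/funext => x; rewrite opprB.
Qed.

Lemma dexpectationZ p c f : is_mass p -> bdd f ->
  dexpectation p (fun x => c * f x) = c * dexpectation p f.
Proof.
move=> mp.
have pos d h : 0 <= d -> bdd h ->
    dexpectation p (fun x => d * h x) = d * dexpectation p h.
  move=> d0 /bdd_posneg[a [b [ba a0 bb b0 ->]]].
  rewrite dexpectationB// mulrBr -!nnexpZ// -dexpectationB//.
  - by congr dexpectation; apply/funext => x; rewrite mulrBr.
  - exact: bddM (bdd_cst _) _.
  - by move=> x; rewrite mulr_ge0.
  - exact: bddM (bdd_cst _) _.
  - by move=> x; rewrite mulr_ge0.
move=> bf; have [c0|/ltW c0] := leP 0 c; first exact: pos.
have := pos (- c) f; rewrite oppr_ge0 => /(_ c0 bf).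
rewrite mulNr => /eqP; rewrite eq_sym eqr_oppLR => /eqP ->.
rewrite -dexpectationN//; last exact: bddM (bdd_cst _) _.
by congr dexpectation; apply/funext => x; rewrite mulNr opprK.
Qed.

Lemma dexpectation_sum p (I : Type) (r : seq I) (F : I -> T -> R) :
  is_mass p -> (forall i, bdd (F i)) ->
  dexpectation p (fun x => \sum_(i <- r) F i x) =
  \sum_(i <- r) dexpectation p (F i).
Proof.
move=> mp bF; elim: r => [|i r IH].
  rewrite big_nil -[RHS](dexpectation0 p); congr dexpectation.
  by apply/funext => x; rewrite big_nil.
rewrite big_cons -IH -dexpectationD//; last exact: bdd_sum.
by congr dexpectation; apply/funext => x; rewrite big_cons.
Qed.

Lemma dexpectation_ge0 p f : is_mass p -> bdd f -> (forall x, 0 <= f x) ->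
  0 <= dexpectation p f.
Proof.
by move=> mp bf f0; rewrite dexpectation_ge0E// nnexp_ge0//; case: mp.
Qed.

Lemma le_dexpectation p f g : is_mass p -> bdd f -> bdd g ->
  (forall x, f x <= g x) -> dexpectation p f <= dexpectation p g.
Proof.
move=> mp bf bg fg.
have bNf := bddN bf; rewrite -subr_ge0 -dexpectationN// -dexpectationD//.
apply: dexpectation_ge0 => //; first exact: bddD.
by move=> x; rewrite subr_ge0.
Qed.

Lemma dexpectation_ind p (P : pred T) : is_mass p ->
  dexpectation p (fun x => (P x)%:R) = prob p [set x | P x].
Proof.
move=> mp; rewrite dexpectation_ge0E//; last exact: bdd_ind.
rewrite /nnexp /prob; congr fine; rewrite [RHS]esum_mkcond.
apply: eq_esum => x _; case: (boolP (P x)) => Px.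
  by rewrite mem_set// mulr1.
by rewrite memNset ?mulr0//; exact/negP.
Qed.

(** Integrating against an indicator amounts to restricting the mass function;
    conditioning on a state is treated through the restricted mass. *)
Lemma dexpectation_restr p (P : pred T) f :
  dexpectation (fun x => if P x then p x else 0) f =
  dexpectation p (fun x => (P x)%:R * f x).
Proof.
rewrite /dexpectation.
have -> : (fun x => (p x * ((P x)%:R * f x))%:E) =
    (fun x => ((if P x then p x else 0) * f x)%:E).
  by apply/funext => x; case: (P x); rewrite ?mul1r ?mul0r ?mulr0.
by [].
Qed.

Lemma prob_restr p (P : pred T) (A : set T) :
  prob (fun x => if P x then p x else 0) A = prob p (A `&` [set x | P x]).
Proof.
rewrite /prob esum_mkcondr; congr fine; apply: eq_esum => x _.
case: (boolP (P x)) => Px; first by rewrite mem_set.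
by rewrite memNset//; exact/negP.
Qed.

Lemma restr_mass p (P : pred T) : is_mass p ->
  is_mass (fun x => if P x then p x else 0).
Proof.
move=> mp; have [p0 _] := mp; split=> [x|]; first by case: ifP.
rewrite (eq_esum (b := fun x => (p x * (P x)%:R)%:E)).
  by apply: esum_mass => //; exact: bdd_ind.
by move=> x _; case: (P x); rewrite ?mulr1 ?mulr0.
Qed.

End expectation.

(** * Laws, conditional independence and finite approximation *)

Section law.
Context {R : realType} {T U : countType}.
Implicit Types (p : T -> R) (phi : T -> U) (f : U -> R).

(** Change of variables: the domain is partitioned into the fibres of [phi],
    so the double sum over fibres is a single sum over the graph of [phi]. *)
Lemma esum_law p phi f : is_mass p -> bdd f -> (forall x, 0 <= f x) ->
  \esum_(y in [set: U]) (law p phi y * f y)%:E =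
  \esum_(x in [set: T]) (p x * f (phi x))%:E.
Proof.
move=> mp bf f0; have [p0 _] := mp.
transitivity (\esum_(y in [set: U]) \esum_(x in phi @^-1` [set y])
    (p x * f (phi x))%:E).
  apply: eq_esum => y _; rewrite mulrC EFinM /law /prob fineK; last first.
    rewrite (eq_esum (b := fun x => (p x * 1)%:E)); last first.
      by move=> x _; rewrite mulr1.
    by apply: esum_mass => //; exact: bdd_cst.
  rewrite -esumZl//; apply: eq_esum => x /= ->.
  by rewrite mulrC.
rewrite esum_esum; last by move=> y x _ _; rewrite lee_fin mulr_ge0.
rewrite (reindex_esum [set: T] _ (fun x => (phi x, x)))//.
split => [x _ //|x y _ _ [] //|[y x] [_ /= <-]].
by exists x.
Qed.

Lemma law_mass p phi : is_mass p -> is_mass (law p phi).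
Proof.
move=> mp; have [p0 pfin] := mp; split=> [y|].
  by apply/fine_ge0/esum_ge0 => x _; rewrite lee_fin.
have := esum_law phi mp (bdd_cst 1) (fun=> ler01).
under eq_esum do rewrite mulr1.
by move=> ->; under eq_esum do rewrite mulr1.
Qed.

Lemma nnexp_law p phi f : is_mass p -> bdd f -> (forall x, 0 <= f x) ->
  nnexp (law p phi) f = nnexp p (fun x => f (phi x)).
Proof. by move=> mp bf f0; rewrite /nnexp esum_law. Qed.

Lemma dexpectation_law p phi f : is_mass p -> bdd f ->
  dexpectation (law p phi) f = dexpectation p (fun x => f (phi x)).
Proof.
move=> mp /bdd_posneg[a [b [ba a0 bb b0 ->]]].
rewrite !dexpectationB//; first by rewrite !nnexp_law.
- exact: bdd_comp.
- exact: bdd_comp.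
- exact: law_mass.
Qed.

Lemma law_distr p phi : is_distr p -> is_distr (law p phi).
Proof.
move=> dp; have mp := distr_mass dp; have [l0 _] := law_mass phi mp.
split=> //; have := esum_law phi mp (bdd_cst 1) (fun=> ler01).
under eq_esum do rewrite mulr1.
move=> ->; under eq_esum do rewrite mulr1.
by case: dp.
Qed.

End law.

Lemma esum_prod {R : realType} {A B : choiceType} (a : A -> R) (b : B -> R) :
  (forall x, 0 <= a x) -> (forall y, 0 <= b y) ->
  \esum_(y in [set: B]) (b y)%:E \is a fin_num ->
  (\esum_(z in [set: A * B]) (a z.1 * b z.2)%:E =
   (\esum_(x in [set: A]) (a x)%:E) * (\esum_(y in [set: B]) (b y)%:E))%E.
Proof.
move=> a0 b0 bfin.
transitivity (\esum_(x in [set: A]) \esum_(y in [set: B]) (a x * b y)%:E).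
  rewrite esum_esum; last by move=> x y _ _; rewrite lee_fin mulr_ge0.
  by congr esum; apply/seteqP; split.
rewrite -(fineK bfin) muleC -esumZl//; last first.
  by apply/fine_ge0/esum_ge0 => y _; rewrite lee_fin.
by apply: eq_esum => x _; rewrite esumZl// -(fineK bfin) mulrC.
Qed.

Section expectation.
Context {R : realType} {T : countType}.
Implicit Types (p : T -> R) (f : T -> R).

Lemma dexpectation1 p : is_distr p -> dexpectation p (fun=> 1) = 1.
Proof.
move=> dp; rewrite dexpectation_ge0E//; [|exact: distr_mass|exact: bdd_cst].
by rewrite /nnexp; under eq_esum do rewrite mulr1; case: dp => _ ->.
Qed.

Lemma distr_le1 p x : is_distr p -> p x <= 1.
Proof.
move=> [p0 p1]; rewrite -lee_fin -p1; apply: esum_ge.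
by exists [set x] => //; rewrite fsbig_set1.
Qed.

(** Conditional independence, given as a product rule on atoms, extends to
    functions: under the mass restricted to the state [w], the joint law of
    the two variables is, up to the factor given by the probability of [w],
    the product of its marginals, and a sum of products over a product set
    factorizes. If [w] has probability zero, both sides vanish, the quotient
    being zero by the convention on division. *)
Lemma cond_indep_dexpectation {A B Z : countType} p
    (X : T -> A) (Y : T -> B) (W : T -> Z) (w : Z) (s : A -> R) (t : B -> R) :
  is_mass p -> cond_indep p X Y W ->
  bdd s -> (forall x, 0 <= s x) -> bdd t -> (forall y, 0 <= t y) ->
  dexpectation p (fun x => (W x == w)%:R * (s (X x) * t (Y x))) =
  dexpectation p (fun x => (W x == w)%:R * s (X x)) *
  (dexpectation p (fun x => (W x == w)%:R * t (Y x)) /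
   prob p (W @^-1` [set w])).
Proof.
move=> mp ci bs s0 bt t0.
rewrite -!(dexpectation_restr p (fun x => W x == w)).
set q := fun x => if W x == w then p x else 0.
have mq : is_mass q by exact: restr_mass.
have bsX : bdd (fun x => s (X x)) by exact: bdd_comp.
have btY : bdd (fun x => t (Y x)) by exact: bdd_comp.
have setW : [set x | W x == w] = W @^-1` [set w].
  by apply/seteqP; split=> x /= /eqP.
have probq S : prob q S = prob p (S `&` W @^-1` [set w]).
  by rewrite /q (prob_restr p (fun x => W x == w)) setW.
set P := prob p _.
have PE : P = dexpectation q (fun=> 1).
  rewrite /q (dexpectation_restr p (fun x => W x == w)).
  rewrite (_ : (fun x => _ * 1) = fun x => (W x == w)%:R); last first.
    by apply/funext => x; rewrite mulr1.
  by rewrite (dexpectation_ind (fun x => W x == w))// setW.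
have [P0|P0] := eqVneq P 0.
  have z f : bdd f -> (forall x, 0 <= f x) -> dexpectation q f = 0.
    move=> bf f0; apply/eqP; rewrite eq_le dexpectation_ge0// andbT.
    have [M fM] := bf.
    have := @le_dexpectation _ _ q f (fun=> M * 1) mq bf.
    rewrite dexpectationZ//; last exact: bdd_cst.
    rewrite -PE P0 mulr0; apply; first exact: bdd_cst.
    by move=> x; rewrite mulr1 (le_trans _ (fM x))// ler_norm.
  rewrite P0 invr0 !mulr0 z//; first exact: bddM.
  by move=> x; exact: mulr_ge0.
have {}P0 : 0 < P.
  rewrite lt_neqAle eq_sym P0 /P /prob.
  by apply/fine_ge0/esum_ge0 => x _; rewrite lee_fin; case: mp.
have lawM x y : law q (fun z => (X z, Y z)) (x, y) * P = law q X x * law q Y y.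
  have := ci x y w P0; rewrite /cprob -/P /law !probq.
  rewrite (_ : (fun z => (X z, Y z)) @^-1` [set (x, y)] =
      X @^-1` [set x] `&` Y @^-1` [set y]); last first.
    by apply/seteqP; split => z /= [-> ->].
  move=> /(congr1 (fun r => r * P * P)).
  by rewrite divfK ?gt_eqF// => ->; field; rewrite gt_eqF.
have bst : bdd (fun z : A * B => s z.1 * t z.2).
  by apply: bddM; exact: bdd_comp.
have st0 (z : A * B) : 0 <= s z.1 * t z.2 by rewrite mulr_ge0.
apply: (mulIf (lt0r_neq0 P0)); rewrite -mulrA divfK ?gt_eqF//.
transitivity (nnexp (law q (fun z => (X z, Y z))) (fun z => s z.1 * t z.2) * P).
  rewrite nnexp_law// -dexpectation_ge0E//=; first exact: bddM.
  by move=> x; exact: mulr_ge0.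
rewrite !dexpectation_ge0E// -(nnexp_law X mq bs s0) -(nnexp_law Y mq bt t0).
rewrite mulrC -nnexpZ//; [|exact: law_mass|exact: ltW].
rewrite /nnexp.
have [lX0 _] := law_mass X mq; have [lY0 _] := law_mass Y mq.
rewrite -fineM; last first.
- by apply: esum_mass => //; exact: law_mass.
- by apply: esum_mass => //; exact: law_mass.
rewrite -esum_prod; last first.
- by apply: esum_mass => //; exact: law_mass.
- by move=> y; rewrite mulr_ge0.
- by move=> x; rewrite mulr_ge0.
congr fine; apply: eq_esum => -[x y] _ /=; congr EFin.
transitivity (law q (fun z => (X z, Y z)) (x, y) * P * (s x * t y)).
  exact: mulrA.
rewrite lawM; ring.
Qed.

Lemma dexpectation_seq p (G : seq T) f : is_mass p -> uniq G ->
  dexpectation p (fun x => (x \in G)%:R * f x) = \sum_(x <- G) p x * f x.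
Proof.
move=> mp uG.
transitivity (dexpectation p (fun x => \sum_(y <- G) f y * (x == y)%:R)).
  congr dexpectation; apply/funext => x.
  case: (boolP (x \in G)) => xG.
    rewrite (bigD1_seq x)//= eqxx mulr1 mul1r big1 ?addr0// => y /negPf.
    by rewrite eq_sym => ->; rewrite mulr0.
  rewrite mul0r big_seq big1// => y yG.
  case: eqP => [xy|_]; last by rewrite mulr0.
  by rewrite xy yG in xG.
rewrite dexpectation_sum//; last first.
  by move=> y; apply: bddM; [exact: bdd_cst|exact: (bdd_ind (fun x => x == y))].
apply: eq_bigr => y _.
rewrite dexpectationZ//; last exact: (bdd_ind (fun x => x == y)).
rewrite (dexpectation_ind (fun x => x == y))// mulrC; congr (_ * _).
rewrite /prob (_ : [set x | x == y] = [set y]); last first.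
  by apply/seteqP; split=> x /= /eqP.
by rewrite esum_set1//= lee_fin; case: mp.
Qed.

(** A finite set of nearly full mass computes all expectations of functions
    bounded by one up to [e], uniformly in the function. The bound persists for
    every larger finite set, which leaves the freedom to choose a product
    set. *)
Lemma dexpectation_approx p (e : R) : is_mass p -> 0 < e ->
  exists F : seq T, forall G : seq T, uniq G -> {subset F <= G} ->
    forall f, (forall x, `|f x| <= 1) ->
    `|dexpectation p f - \sum_(x <- G) p x * f x| <= e.
Proof.
move=> mp e0; have [p0 pfin] := mp.
set P := fine (\esum_(x in [set: T]) (p x)%:E).
have PE : P = dexpectation p (fun=> 1).
  rewrite dexpectation_ge0E//; last exact: bdd_cst.
  by rewrite /nnexp; under [in RHS]eq_esum do rewrite mulr1.
have : ((P - e)%:E < \esum_(x in [set: T]) (p x)%:E)%E.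
  by rewrite -(fineK pfin) lte_fin ltrBlDr ltrDl.
move=> /ereal_sup_gt[_ [X [finX _] <-]].
rewrite fsbig_finite//= sumEFin lte_fin => XP.
exists (finmap.enum_fset (fset_set X)) => G uG XG f f1.
have bf : bdd f by exists 1.
have bi (H : seq T) : bdd (fun x => (x \in H)%:R : R).
  exact: (bdd_ind (fun x => x \in H)).
have sumE (H : seq T) : uniq H ->
    \sum_(x <- H) p x = dexpectation p (fun x => (x \in H)%:R).
  move=> uH; have := dexpectation_seq (fun=> 1) mp uH.
  under [RHS]eq_bigr do rewrite mulr1.
  by move=> <-; congr dexpectation; apply/funext => x; rewrite mulr1.
have GP : P - e < dexpectation p (fun x => (x \in G)%:R).
  apply: (lt_le_trans XP); rewrite sumE ?finmap.fset_uniq//.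
  apply: le_dexpectation => //.
  by move=> x; rewrite ler_nat; case: (boolP (x \in _)) => // /XG ->.
have bn : bdd (fun x => (x \notin G)%:R : R).
  exact: (bdd_ind (fun x => x \notin G)).
have -> : dexpectation p f - \sum_(x <- G) p x * f x =
    dexpectation p (fun x => (x \notin G)%:R * f x).
  rewrite -dexpectation_seq//; apply/eqP; rewrite subr_eq addrC.
  rewrite -dexpectationD//; [|exact: bddM..].
  apply/eqP; congr dexpectation; apply/funext => x.
  by case: (x \in G); rewrite /= ?mul0r ?mul1r ?addr0 ?add0r.
have : dexpectation p (fun x => (x \notin G)%:R) <= e.
  have : P = dexpectation p (fun x => (x \in G)%:R) +
             dexpectation p (fun x => (x \notin G)%:R).
    rewrite PE -dexpectationD//; congr dexpectation; apply/funext => x.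
    by case: (x \in G); rewrite /= ?addr0 ?add0r.
  by lra.
apply: le_trans; rewrite ler_norml -dexpectationN//; apply/andP; split.
  apply: le_dexpectation => //; [exact: bddN|exact: bddM|] => x.
  case: (x \in G); rewrite ?mul0r ?oppr0// mul1r.
  by have := f1 x; rewrite ler_norml => /andP[].
apply: le_dexpectation => //; [exact: bddM|] => x.
case: (x \in G); rewrite ?mul0r ?oppr0// mul1r.
by have := f1 x; rewrite ler_norml => /andP[].
Qed.

End expectation.

(** * Regret matching *)

Section regret.
Context {R : realType}.

Lemma sqr_pospart_add (r a : R) :
  Num.max (r + a) 0 ^+ 2 <= Num.max r 0 ^+ 2 + 2 * (Num.max r 0 * a) + a ^+ 2.
Proof. by case: (leP (r + a) 0); case: (leP r 0); nra. Qed.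

(** Playing each action with probability proportional to its positive regret
    makes the next regret vector orthogonal to the positive part of the current
    one, whatever the payoffs [a] turn out to be. *)
Lemma regret_matching (I : finType) (r : I -> R) : (0 < #|I|)%N ->
  exists x, is_mixed x /\
    forall a : I -> R, \sum_i Num.max (r i) 0 * (a i - \sum_l x l * a l) = 0.
Proof.
move=> /card_gt0P[i0 _].
pose m i := Num.max (r i) 0; pose S := \sum_i m i.
have m0 i : 0 <= m i by rewrite le_max lexx orbT.
have [S0|S0] := eqVneq S 0.
  (* Without positive regret the condition is void and any action will do. *)
  exists (fun i => (i == i0)%:R); split.
    split=> [i|]; first by rewrite ler0n.
    by rewrite (bigD1 i0)//= eqxx big1 ?addr0// => i /negPf ->.
  have mz i : m i = 0 by apply/(psumr_eq0P _ S0).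
  by move=> a; rewrite big1// => i _; rewrite -/(m i) mz mul0r.
exists (fun i => m i / S); split.
  split=> [i|]; first by rewrite divr_ge0// sumr_ge0.
  by rewrite -mulr_suml divff.
move=> a; under eq_bigr do rewrite mulrBr.
rewrite sumrB -mulr_suml -/S mulr_sumr -sumrB big1// => i _.
by rewrite -/(m i) mulrA mulrCA mulfV// mulr1 subrr.
Qed.

Lemma mixed_norm_le (I : finType) (x a : I -> R) c : is_mixed x ->
  (forall i, `|a i| <= c) -> `|\sum_i x i * a i| <= c.
Proof.
move=> [x0 x1] ac; rewrite (le_trans (ler_norm_sum _ _ _))//.
rewrite -[leRHS]mul1r -x1 mulr_suml; apply: ler_sum => i _.
by rewrite normrM ger0_norm// ler_wpM2l.
Qed.

(** By orthogonality the cross term vanishes, so the squared norm of the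
    positive regrets grows by at most a constant per stage: after [n] stages
    the regret is of order [sqrt n]. *)
Lemma regret_step (I : finType) (r : I -> R) (c : R) : (0 < #|I|)%N ->
  exists x, is_mixed x /\ forall a : I -> R, (forall i, `|a i| <= c) ->
    \sum_i Num.max (r i + (a i - \sum_l x l * a l)) 0 ^+ 2 <=
    \sum_i Num.max (r i) 0 ^+ 2 + #|I|%:R * (2 * c) ^+ 2.
Proof.
move=> I0; have [x [mx xr]] := regret_matching r I0.
exists x; split=> // a ac; have sc := mixed_norm_le mx ac.
set s := \sum_l _ in sc *.
apply: (@le_trans _ _ (\sum_i (Num.max (r i) 0 ^+ 2 +
   2 * (Num.max (r i) 0 * (a i - s)) + (2 * c) ^+ 2))).
  apply: ler_sum => i _; apply: (le_trans (sqr_pospart_add _ _)).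
  rewrite lerD2l; have := ac i; move: sc.
  by rewrite !ler_norml => /andP[? ?] /andP[? ?]; nra.
by rewrite !big_split/= -mulr_sumr xr mulr0 addr0 sumr_const
  -[X in _ + X <= _]mulr_natl.
Qed.

Lemma le_of_sqr_le (s : R) (I : finType) (z : I -> R) : 0 <= s ->
  \sum_i Num.max (z i) 0 ^+ 2 <= s ^+ 2 -> forall i, z i <= s.
Proof.
move=> s0 zs i; have z2 : Num.max (z i) 0 ^+ 2 <= s ^+ 2.
  apply: le_trans zs; rewrite (bigD1 i)//= lerDl.
  by apply: sumr_ge0 => j _; exact: sqr_ge0.
rewrite ler_pXn2r ?nnegrE// in z2; last by rewrite le_max lexx orbT.
by rewrite (le_trans _ z2)// le_max lexx.
Qed.

Lemma sum_mixed_le (I : finType) (x z : I -> R) s : is_mixed x ->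
  (forall i, z i <= s) -> \sum_i x i * z i <= s.
Proof.
move=> [x0 x1] zs; rewrite -[leRHS]mul1r -x1 mulr_suml.
by apply: ler_sum => i _; exact: ler_wpM2l.
Qed.

Lemma mixed_le1 (I : finType) (x : I -> R) i : is_mixed x -> 0 <= x i <= 1.
Proof.
move=> [x0 x1]; rewrite x0 -x1 (bigD1 i)//= lerDl.
by apply: sumr_ge0.
Qed.

Lemma mixed_exists (L : finType) : (0 < #|L|)%N ->
  exists x : L -> R, is_mixed x.
Proof.
by move=> L0; have [x [mx _]] := regret_matching (fun=> 0 : R) L0; exists x.
Qed.

Lemma strategy_nonempty (S : countType) (L : finType) : (0 < #|L|)%N ->
  @strategy R S L !=set0.
Proof. by move=> /mixed_exists[x mx]; exists (fun=> x). Qed.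

End regret.

(** * Approximate saddle points with finitely many signals *)

Section finite_game.
Context {R : realType} {S1 S2 : Type} {I J : finType}.
Hypotheses (I0 : (0 < #|I|)%N) (J0 : (0 < #|J|)%N).
Variables (A : seq S1) (B : seq S2) (M : S1 -> I -> S2 -> J -> R) (m : R).
Hypotheses (m0 : 0 <= m).
Hypothesis Mm : forall a i b j, `|M a i b j| <= m.
Implicit Types (x : S1 -> I -> R) (y : S2 -> J -> R).

(** What action [i] at signal [a] earns against [y]; player 1 runs a separate
    regret minimization at each signal with these payoffs. *)
Definition reply1 y a i := \sum_(b <- B) \sum_j y b j * M a i b j.
Definition reply2 x b j := \sum_(a <- A) \sum_i x a i * M a i b j.
Definition fpay x y :=
  \sum_(a <- A) \sum_(b <- B) \sum_i \sum_j x a i * y b j * M a i b j.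

Lemma fpay1 x y : fpay x y = \sum_(a <- A) \sum_i x a i * reply1 y a i.
Proof.
apply: eq_bigr => a _; rewrite exchange_big/=; apply: eq_bigr => i _.
rewrite mulr_sumr; apply: eq_bigr => b _; rewrite mulr_sumr.
by apply: eq_bigr => j _; rewrite mulrA.
Qed.

Lemma fpay2 x y : fpay x y = \sum_(b <- B) \sum_j y b j * reply2 x b j.
Proof.
rewrite /fpay exchange_big/=; apply: eq_bigr => b _.
under eq_bigr do rewrite exchange_big/=.
rewrite exchange_big/=; apply: eq_bigr => j _; rewrite mulr_sumr.
apply: eq_bigr => a _; rewrite mulr_sumr; apply: eq_bigr => i _; ring.
Qed.

Let c : R := m * (size A + size B)%:R.

Lemma reply1_le y : (forall b, is_mixed (y b)) ->
  forall a i, `|reply1 y a i| <= c.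
Proof.
move=> my a i; rewrite (le_trans (ler_norm_sum _ _ _))//.
apply: (@le_trans _ _ (\sum_(b <- B) m)).
  by apply: ler_sum => b _; exact: mixed_norm_le.
rewrite big_const_seq count_predT iter_addr_0 -mulr_natr /c.
by rewrite ler_wpM2l// ler_nat leq_addl.
Qed.

Lemma reply2_le x : (forall a, is_mixed (x a)) ->
  forall b j, `|reply2 x b j| <= c.
Proof.
move=> mx b j; rewrite (le_trans (ler_norm_sum _ _ _))//.
apply: (@le_trans _ _ (\sum_(a <- A) m)).
  by apply: ler_sum => a _; apply: mixed_norm_le.
rewrite big_const_seq count_predT iter_addr_0 -mulr_natr /c.
by rewrite ler_wpM2l// ler_nat leq_addr.
Qed.

Lemma reply1D y y' a i :
  reply1 (fun b j => y b j + y' b j) a i = reply1 y a i + reply1 y' a i.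
Proof.
rewrite -big_split; apply: eq_bigr => b _; rewrite -big_split.
by apply: eq_bigr => j _; rewrite mulrDl.
Qed.

Lemma reply2D x x' b j :
  reply2 (fun a i => x a i + x' a i) b j = reply2 x b j + reply2 x' b j.
Proof.
rewrite -big_split; apply: eq_bigr => a _; rewrite -big_split.
by apply: eq_bigr => i _; rewrite mulrDl.
Qed.

(** The state of [n] stages of simultaneous regret matching. [X] and [Y] are the
    sums of the strategies played, [w1] and [w2] the payoffs accumulated at each
    signal. As replies are linear, the cumulative regrets of player 1 are
    [reply1 Y a i - w1 a], and those of player 2 have the opposite sign because
    player 2 minimizes. *)
Lemma regret_play (n : nat) : exists X Y (w1 : S1 -> R) (w2 : S2 -> R),
  [/\ (forall a, (forall i, 0 <= X a i) /\ \sum_i X a i = n%:R),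
      (forall b, (forall j, 0 <= Y b j) /\ \sum_j Y b j = n%:R),
      \sum_(a <- A) w1 a = \sum_(b <- B) w2 b,
      (forall a, \sum_i Num.max (reply1 Y a i - w1 a) 0 ^+ 2 <=
                 n%:R * (#|I|%:R * (2 * c) ^+ 2)) &
      (forall b, \sum_j Num.max (w2 b - reply2 X b j) 0 ^+ 2 <=
                 n%:R * (#|J|%:R * (2 * c) ^+ 2))].
Proof.
elim: n => [|n [X [Y [w1 [w2 [HX HY w12 H1 H2]]]]]].
  exists (fun=> fun=> 0), (fun=> fun=> 0), (fun=> 0), (fun=> 0); split.
  - by move=> a; split=> //; rewrite big1.
  - by move=> a; split=> //; rewrite big1.
  - by rewrite !big1.
  - move=> a; rewrite mul0r big1// => i _.
    rewrite /reply1 big1 ?subrr ?maxxx ?expr0n// => b _.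
    by rewrite big1// => j _; rewrite mul0r.
  - move=> b; rewrite mul0r big1// => j _.
    rewrite /reply2 big1 ?subrr ?maxxx ?expr0n// => a _.
    by rewrite big1// => i _; rewrite mul0r.
have [x xP] := choice
  (fun a => regret_step (fun i => reply1 Y a i - w1 a) c I0).
have [y yP] := choice
  (fun b => regret_step (fun j => w2 b - reply2 X b j) c J0).
have mx a : is_mixed (x a) by case: (xP a).
have my b : is_mixed (y b) by case: (yP b).
exists (fun a i => X a i + x a i), (fun b j => Y b j + y b j),
  (fun a => w1 a + \sum_i x a i * reply1 y a i),
  (fun b => w2 b + \sum_j y b j * reply2 x b j); split.
- move=> a; have [X0 X1] := HX a; have [x0 x1] := mx a; split=> [i|].
    by rewrite addr_ge0.
  by rewrite big_split/= X1 x1 -natr1.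
- move=> b; have [Y0 Y1] := HY b; have [y0 y1] := my b; split=> [j|].
    by rewrite addr_ge0.
  by rewrite big_split/= Y1 y1 -natr1.
- by rewrite !big_split/= w12 -fpay1 -fpay2.
- move=> a; rewrite -natr1 mulrDl mul1r.
  apply: le_trans (lerD (H1 a) (lexx _)).
  have [_ /(_ (reply1 y a) (reply1_le my a))] := xP a.
  apply: le_trans; rewrite le_eqVlt; apply/orP; left; apply/eqP.
  by apply: eq_bigr => i _; rewrite reply1D opprD addrACA.
- move=> b; rewrite -natr1 mulrDl mul1r.
  apply: le_trans (lerD (H2 b) (lexx _)).
  have [_ /(_ (fun j => - reply2 x b j))] := yP b.
  have bnd j : `|- reply2 x b j| <= c by rewrite normrN reply2_le.
  move=> /(_ bnd); apply: le_trans.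
  rewrite le_eqVlt; apply/orP; left; apply/eqP.
  apply: eq_bigr => j _; rewrite reply2D.
  under [in RHS]eq_bigr do rewrite mulrN.
  by rewrite sumrN opprK; congr (Num.max _ _ ^+ 2); ring.
Qed.

(** The averages of the strategies over a long play of regret matching form an
    approximate saddle point: the total regret is sublinear in the number of
    stages, so neither player gains more than [e] per stage by a fixed
    deviation. *)
Lemma finite_minimax (e : R) : 0 < e ->
  exists (x : S1 -> I -> R) (y : S2 -> J -> R) v,
  [/\ forall a, is_mixed (x a), forall b, is_mixed (y b),
     forall x' : S1 -> I -> R, (forall a, is_mixed (x' a)) ->
       fpay x' y <= v + e &
     forall y' : S2 -> J -> R, (forall b, is_mixed (y' b)) ->
       v - e <= fpay x y'].
Proof.
move=> e0.
set L := (size A + size B)%:R : R.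
(* [d] is the admissible average regret at one signal; the denominator is
   shifted by one to stay positive when there are no signals. *)
pose d := e / (L + 1).
have L0 : 0 <= L by rewrite ler0n.
have d0 : 0 < d by rewrite divr_gt0// ltr_wpDl.
have Ld : L * d <= e.
  by rewrite /d mulrCA ger_pMr// ler_pdivrMr ?mul1r ?lerDl// ltr_wpDl.
(* Since the squared regrets are at most [n * kap], any [n >= kap / d ^ 2]
   makes the regrets at most [n * d], without square roots. *)
pose kap := (#|I|%:R + #|J|%:R) * (2 * c) ^+ 2.
have [n nP] : exists n : nat, kap / d ^+ 2 < n.+1%:R.
  exists (Num.truncn (kap / d ^+ 2)); apply: truncnS_gt.
set N := n.+1%:R : R in nP; have N0 : 0 < N by rewrite ltr0n.
have {nP} kapN : N * kap <= (N * d) ^+ 2.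
  rewrite ltr_pdivrMr ?exprn_gt0// in nP.
  by rewrite exprMn expr2 -mulrA ler_pM2l// ltW.
have [X [Y [w1 [w2 [HX HY w12 H1 H2]]]]] := regret_play n.+1.
have kI : N * (#|I|%:R * (2 * c) ^+ 2) <= (N * d) ^+ 2.
  apply: le_trans kapN; rewrite ler_pM2l// ler_wpM2r ?sqr_ge0//.
  by rewrite lerDl.
have kJ : N * (#|J|%:R * (2 * c) ^+ 2) <= (N * d) ^+ 2.
  apply: le_trans kapN; rewrite ler_pM2l// ler_wpM2r ?sqr_ge0//.
  by rewrite lerDr.
have Nd0 : 0 <= N * d by rewrite mulr_ge0// ltW.
have {}H1 a i : reply1 Y a i <= w1 a + N * d.
  rewrite -lerBlDl; exact: (le_of_sqr_le Nd0 (le_trans (H1 a) kI) i).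
have {}H2 b j : w2 b - N * d <= reply2 X b j.
  by rewrite lerBlDl -lerBlDr; exact: (le_of_sqr_le Nd0 (le_trans (H2 b) kJ) j).
pose V := \sum_(a <- A) w1 a.
exists (fun a i => X a i / N), (fun b j => Y b j / N), (V / N); split.
- move=> a; have [X0 X1] := HX a; split=> [i|]; first by rewrite divr_ge0// ltW.
  by rewrite -mulr_suml X1 divff// gt_eqF.
- move=> b; have [Y0 Y1] := HY b; split=> [j|]; first by rewrite divr_ge0// ltW.
  by rewrite -mulr_suml Y1 divff// gt_eqF.
- move=> x' mx'.
  have -> : fpay x' (fun b j => Y b j / N) = fpay x' Y / N.
    rewrite /fpay; do 4 (rewrite mulr_suml; apply: eq_bigr => ? _); ring.
  rewrite ler_pdivrMr// mulrDl divfK ?gt_eqF// fpay1.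
  apply: (@le_trans _ _ (\sum_(a <- A) (w1 a + N * d))).
    by apply: ler_sum => a _; exact: sum_mixed_le.
  rewrite big_split/= lerD2l big_const_seq count_predT iter_addr_0 -mulr_natr.
  rewrite -mulrA mulrC ler_pM2r// (le_trans _ Ld)// mulrC ler_pM2r// /L.
  by rewrite ler_nat leq_addr.
- move=> y' my'.
  have -> : fpay (fun a i => X a i / N) y' = fpay X y' / N.
    rewrite /fpay; do 4 (rewrite mulr_suml; apply: eq_bigr => ? _); ring.
  rewrite ler_pdivlMr// mulrBl divfK ?gt_eqF// fpay2.
  apply: (@le_trans _ _ (\sum_(b <- B) (w2 b - N * d))).
    rewrite sumrB /V w12 lerD2l lerN2 big_const_seq count_predT iter_addr_0.
    rewrite -mulr_natr.
    rewrite -mulrA mulrC ler_pM2r// (le_trans _ Ld)// mulrC ler_pM2r// /L.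
    by rewrite ler_nat leq_addl.
  apply: ler_sum => b _; rewrite -lerN2 -sumrN.
  under eq_bigr do rewrite -mulrN.
  by apply: sum_mixed_le => // j; rewrite lerN2.
Qed.

End finite_game.

(** * Maxmin, minmax and approximate saddle points *)

Section saddle.
Context {R : realType} {S T : Type}.
Variables (X : set S) (Y : set T) (P : S -> T -> R) (c : R).
Hypotheses (X0 : X !=set0) (Y0 : Y !=set0).
Hypothesis Pc : forall x y, X x -> Y y -> `|P x y| <= c.

Let lower : R := sup [set inf [set P x y | y in Y] | x in X].
Let upper : R := inf [set sup [set P x y | x in X] | y in Y].

Lemma inf_payoff_le x y : X x -> Y y -> inf [set P x y' | y' in Y] <= P x y.
Proof.
move=> Xx Yy; apply: ge_inf; last by exists y.
by exists (- c) => _ [z Yz <-]; have := Pc Xx Yz; rewrite ler_norml => /andP[].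
Qed.

Lemma le_sup_payoff x y : X x -> Y y -> P x y <= sup [set P x' y | x' in X].
Proof.
move=> Xx Yy; apply: ub_le_sup; last by exists x.
by exists c => _ [z Xz <-]; have := Pc Xz Yy; rewrite ler_norml => /andP[].
Qed.

Lemma le_supinf x r : X x -> (forall y, Y y -> r <= P x y) -> r <= lower.
Proof.
move=> Xx rP; apply: (@le_trans _ _ (inf [set P x y | y in Y])).
  have [y0 Yy0] := Y0.
  apply: lb_le_inf; first by exists (P x y0), y0.
  by move=> _ [y Yy <-]; exact: rP.
apply: ub_le_sup; last by exists x.
have [y0 Yy0] := Y0; exists c => _ [z Xz <-].
apply: (le_trans (inf_payoff_le Xz Yy0)).
by have := Pc Xz Yy0; rewrite ler_norml => /andP[].
Qed.

Lemma infsup_le y r : Y y -> (forall x, X x -> P x y <= r) -> upper <= r.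
Proof.
move=> Yy rP; apply: (@le_trans _ _ (sup [set P x y | x in X])); last first.
  have [x0 Xx0] := X0.
  apply: ge_sup; first by exists (P x0 y), x0.
  by move=> _ [x Xx <-]; exact: rP.
apply: ge_inf; last by exists y.
have [x0 Xx0] := X0; exists (- c) => _ [z Yz <-].
apply: le_trans (le_sup_payoff Xx0 Yz).
by have := Pc Xx0 Yz; rewrite ler_norml => /andP[].
Qed.

Lemma supinf_le_infsup : lower <= upper.
Proof.
have [x0 Xx0] := X0; have [y0 Yy0] := Y0.
apply: ge_sup; first by exists (inf [set P x0 y | y in Y]), x0.
move=> _ [x Xx <-]; apply: lb_le_inf.
  by exists (sup [set P x y0 | x in X]), y0.
move=> _ [y Yy <-].
exact: le_trans (inf_payoff_le Xx Yy) (le_sup_payoff Xx Yy).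
Qed.

Lemma supinf_eq_infsup :
  (forall e, 0 < e -> exists x y v, [/\ X x, Y y,
    forall x', X x' -> P x' y <= v + e & forall y', Y y' -> v - e <= P x y']) ->
  lower = upper.
Proof.
move=> H; apply/eqP; rewrite eq_le supinf_le_infsup/=.
apply/ler_addgt0Pr => e e0.
have e20 : 0 < e / 2 by rewrite divr_gt0.
have [x [y [v [Xx Yy hi lo]]]] := H _ e20.
have := infsup_le Yy hi; have := le_supinf Xx lo; lra.
Qed.

End saddle.

(** * Existence of the value with countably many signals *)

Section game.
Context {R : realType} {K : finType} {S1 S2 : countType} {I J : finType}.
Variables (u : K * S1 * S2 -> R) (g : K -> I -> J -> R).
Hypotheses (du : is_distr u) (pg : is_payoff g).

Definition stage_payoff (k : K) (x : I -> R) (y : J -> R) : R :=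
  \sum_i \sum_j x i * y j * g k i j.

Lemma stage_payoff_le1 k x y : is_mixed x -> is_mixed y ->
  `|stage_payoff k x y| <= 1.
Proof.
move=> mx my; rewrite /stage_payoff.
rewrite (eq_bigr (fun i => x i * \sum_j y j * g k i j)); last first.
  by move=> i _; rewrite mulr_sumr; apply: eq_bigr => j _; rewrite mulrA.
apply: mixed_norm_le => // i; apply: mixed_norm_le => // j.
by have [_ _] := pg; rewrite ler_norml.
Qed.

Lemma payoffE s t : payoff u g s t =
  dexpectation u (fun x => stage_payoff x.1.1 (s x.1.2) (t x.2)).
Proof. by congr dexpectation; apply/funext => -[[k a] b]. Qed.

Lemma bdd_stage_payoff s t : strategy S1 I s -> strategy S2 J t ->
  bdd (fun x : K * S1 * S2 => stage_payoff x.1.1 (s x.1.2) (t x.2)).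
Proof. by move=> ms mt; exists 1 => x; exact: stage_payoff_le1. Qed.

Lemma payoff_le1 s t : strategy S1 I s -> strategy S2 J t ->
  `|payoff u g s t| <= 1.
Proof.
move=> ms mt; rewrite payoffE -(dexpectation1 du).
have mu := distr_mass du; have bs := bdd_stage_payoff ms mt.
have b1 (k : R) : bdd (fun _ : K * S1 * S2 => k) by exact: bdd_cst.
have H x := stage_payoff_le1 x.1.1 (ms x.1.2) (mt x.2) : `|_| <= 1.
rewrite ler_norml -dexpectationN//; apply/andP; split.
  apply: le_dexpectation => // x.
  by have := H x; rewrite ler_norml => /andP[].
apply: le_dexpectation => // x.
by have := H x; rewrite ler_norml => /andP[].
Qed.

(** Up to [e / 2], the payoff is a finite sum over a product of finitely many
    signals of each player, uniformly in the strategies; hence an approximate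
    saddle point of the finite game is one of the countable game. *)
Lemma game_approx_saddle e : 0 < e -> exists s t v,
  [/\ strategy S1 I s, strategy S2 J t,
    forall s', strategy S1 I s' -> payoff u g s' t <= v + e &
    forall t', strategy S2 J t' -> v - e <= payoff u g s t'].
Proof.
move=> e0; have e20 : 0 < e / 2 by rewrite divr_gt0.
have [I0 J0 g1] := pg.
have [F HF] := dexpectation_approx (distr_mass du) e20.
pose A := undup [seq x.1.2 | x <- F]; pose B := undup [seq x.2 | x <- F].
pose G := [seq (z, b) | z <- [seq (k, a) | k <- enum K, a <- A], b <- B].
have uG : uniq G.
  apply: allpairs_uniq; rewrite ?undup_uniq//; last by move=> [? ?] [? ?].
  apply: allpairs_uniq; rewrite ?undup_uniq ?enum_uniq//; by move=> [? ?] [? ?].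
have FG : {subset F <= G}.
  move=> [[k a] b] xF; apply: allpairs_f; last first.
    by rewrite mem_undup; apply/mapP; exists (k, a, b).
  apply: allpairs_f; first by rewrite mem_enum.
  by rewrite mem_undup; apply/mapP; exists (k, a, b).
pose M a i b j := \sum_k u (k, a, b) * g k i j.
have [u0 _] := du.
have Mle a i b j : `|M a i b j| <= #|K|%:R.
  rewrite (le_trans (ler_norm_sum _ _ _))// -sum1_card natr_sum.
  apply: ler_sum => k _; rewrite normrM ger0_norm//.
  by rewrite mulr_ile1// ?distr_le1// ler_norml.
have near s t : strategy S1 I s -> strategy S2 J t ->
    `|payoff u g s t - fpay A B M s t| <= e / 2.
  move=> ms mt; rewrite payoffE.
  have := HF G uG FG (fun x => stage_payoff x.1.1 (s x.1.2) (t x.2)).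
  move=> /(_ (fun x => stage_payoff_le1 _ (ms _) (mt _))).
  rewrite big_allpairs big_allpairs big_enum/= exchange_big/=.
  congr (`|_ - _| <= _); rewrite /fpay; apply: eq_bigr => a _.
  rewrite exchange_big/=; apply: eq_bigr => b _.
  rewrite /stage_payoff; under eq_bigr do rewrite mulr_sumr.
  rewrite exchange_big/=; apply: eq_bigr => i _.
  under eq_bigr do rewrite mulr_sumr.
  rewrite exchange_big/=; apply: eq_bigr => j _.
  by rewrite /M mulr_sumr; apply: eq_bigr => k _; rewrite mulrCA.
have [s [t [v [ms mt hi lo]]]] := finite_minimax I0 J0 A B (ler0n _ _) Mle e20.
exists s, t, v; split=> // [s' ms'|t' mt'].
  have := near _ _ ms' mt; have := hi _ ms'.
  by rewrite ler_norml => ? /andP[]; lra.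
have := near _ _ ms mt'; have := lo _ mt'; rewrite ler_norml => ? /andP[]; lra.
Qed.

Let X0 : @strategy R S1 I !=set0.
Proof. by apply: strategy_nonempty; case: pg. Qed.
Let Y0 : @strategy R S2 J !=set0.
Proof. by apply: strategy_nonempty; case: pg. Qed.

Lemma maxmin_eq_minmax : maxmin u g = minmax u g.
Proof.
exact: (supinf_eq_infsup X0 Y0 payoff_le1 game_approx_saddle).
Qed.

Lemma game_valueE : game_value u g = maxmin u g /\ game_value u g = minmax u g.
Proof.
have E : game_value u g = maxmin u g.
  apply: xget_unique; first by split=> //; rewrite maxmin_eq_minmax.
  by move=> y [].
by split=> //; rewrite E maxmin_eq_minmax.
Qed.

Lemma game_value_ge s r : strategy S1 I s ->
  (forall t, strategy S2 J t -> r <= payoff u g s t) -> r <= game_value u g.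
Proof.
by move=> ms H; rewrite game_valueE.1; exact: (le_supinf Y0 payoff_le1 ms H).
Qed.

Lemma game_value_le t r : strategy S2 J t ->
  (forall s, strategy S1 I s -> payoff u g s t <= r) -> game_value u g <= r.
Proof.
by move=> mt H; rewrite game_valueE.2; exact: (infsup_le X0 payoff_le1 mt H).
Qed.

Lemma game_value_optimal e : 0 < e -> exists s t,
  [/\ strategy S1 I s, strategy S2 J t,
    forall t', strategy S2 J t' -> game_value u g - e <= payoff u g s t' &
    forall s', strategy S1 I s' -> payoff u g s' t <= game_value u g + e].
Proof.
move=> e0; have e20 : 0 < e / 2 by rewrite divr_gt0.
have [s [t [v [ms mt hi lo]]]] := game_approx_saddle e20.
have := game_value_ge ms lo; have := game_value_le mt hi => vle vge.
exists s, t; split=> // [t' mt'|s' ms'].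
  by have := lo _ mt'; lra.
by have := hi _ ms'; lra.
Qed.

Lemma game_value_le1 : `|game_value u g| <= 1.
Proof.
have [s0 ms0] := X0; have [t0 mt0] := Y0.
rewrite ler_norml; apply/andP; split.
  apply: (game_value_ge ms0) => t mt.
  by have := payoff_le1 ms0 mt; rewrite ler_norml => /andP[].
apply: (game_value_le mt0) => s ms.
by have := payoff_le1 ms mt0; rewrite ler_norml => /andP[].
Qed.

End game.

Lemma payoff_law {R : realType} {T S1 S2 : countType} {K I J : finType}
    (u : T -> R) (phi : T -> K * S1 * S2) (g : K -> I -> J -> R) s t :
  is_distr u -> is_payoff g -> strategy S1 I s -> strategy S2 J t ->
  payoff (law u phi) g s t = dexpectation u (fun x =>
    stage_payoff g (phi x).1.1 (s (phi x).1.2) (t (phi x).2)).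
Proof.
move=> du pg ms mt; rewrite payoffE (dexpectation_law phi (distr_mass du))//.
exact: bdd_stage_payoff.
Qed.

(** * Averaging out the action of player 2 *)

Section averaging.
Context {R : realType} {T A B : countType} {K I J : finType}.
Variables (u : T -> R) (X : T -> A) (Y : T -> B) (W : T -> K).
Variables (g : K -> I -> J -> R) (t : B -> J -> R).
Hypotheses (du : is_distr u) (ci : cond_indep u X Y W).
Hypotheses (pg : is_payoff g) (mt : strategy B J t).

(** The probability that player 2, using [t], plays [j] in state [k]; it is zero
    for every [j] in a state of probability zero. *)
Definition cond_action (k : K) (j : J) : R :=
  dexpectation u (fun x => (W x == k)%:R * t (Y x) j) /
  prob u (W @^-1` [set k]).

(** Fixing the strategy [t] of player 2 turns the game into a decision problem
    of player 1, encoded as a game where player 2 has a single action. *)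
Definition averaged_payoff (k : K) (i : I) (_ : unit) : R :=
  \sum_j cond_action k j * g k i j.

Let mu : is_mass u := distr_mass du.

Lemma bdd_strategy {S : countType} {L : finType}
    (s : S -> L -> R) (Z : T -> S) l :
  strategy S L s -> bdd (fun x => s (Z x) l).
Proof. by move=> ms; apply: bdd_le01 => x; exact: mixed_le1. Qed.

Lemma bdd_state (k : K) : bdd (fun x => (W x == k)%:R : R).
Proof. exact: (bdd_ind (fun x => W x == k)). Qed.

Lemma cond_action_ge0 k j : 0 <= cond_action k j.
Proof.
apply: divr_ge0.
  apply: dexpectation_ge0 => //.
    by apply: bddM; [exact: bdd_state|exact: bdd_strategy].
  by move=> x; rewrite mulr_ge0// ?ler0n//; case: (mt (Y x)).
by apply/fine_ge0/esum_ge0 => x _; rewrite lee_fin; case: mu.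
Qed.

Lemma sum_cond_action_le1 k : \sum_j cond_action k j <= 1.
Proof.
have bF j : bdd (fun x => (W x == k)%:R * t (Y x) j).
  by apply: bddM; [exact: bdd_state|exact: bdd_strategy].
rewrite -mulr_suml -(dexpectation_sum _ mu bF).
rewrite (_ : (fun x => _) = fun x => (W x == k)%:R); last first.
  apply/funext => x; rewrite -mulr_sumr.
  by case: (mt (Y x)) => _ ->; rewrite mulr1.
rewrite (dexpectation_ind (fun x => W x == k))//.
rewrite (_ : [set x | W x == k] = W @^-1` [set k]); last first.
  by apply/seteqP; split => x /= /eqP.
by have [->|P0] := eqVneq (prob u (W @^-1` [set k])) 0; rewrite ?mul0r// divff.
Qed.

Lemma averaged_is_payoff : is_payoff averaged_payoff.
Proof.
have [I0 J0 g1] := pg; split=> // [|k i j0]; first by rewrite card_unit.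
rewrite -ler_norml (le_trans (ler_norm_sum _ _ _))//.
apply: le_trans (sum_cond_action_le1 k); apply: ler_sum => j _.
rewrite normrM ger0_norm ?cond_action_ge0//.
by rewrite ler_piMr ?cond_action_ge0// ler_norml.
Qed.

(** Given the state, the signal of player 2 carries no information on that of
    player 1, so its contribution can be averaged out state by state. *)
Lemma averaged_payoffE (s : A -> I -> R) (y : T -> unit -> R) :
  strategy A I s ->
  (forall x, is_mixed (y x)) ->
  dexpectation u (fun x => stage_payoff averaged_payoff (W x) (s (X x)) (y x)) =
  dexpectation u (fun x => stage_payoff g (W x) (s (X x)) (t (Y x))).
Proof.
move=> ms my.
have bs i : bdd (fun x => s (X x) i) by exact: bdd_strategy.
have bt j : bdd (fun x => t (Y x) j) by exact: bdd_strategy.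
have pick (f : K -> R) k : f k = \sum_l (k == l)%:R * f l.
  rewrite (bigD1 k)//= eqxx mul1r big1 ?addr0// => l /negPf.
  by rewrite eq_sym => ->; rewrite mul0r.
transitivity (\sum_i \sum_k \sum_j g k i j *
    (dexpectation u (fun x => (W x == k)%:R * s (X x) i) * cond_action k j)).
  rewrite (_ : (fun x => _) = fun x => \sum_i \sum_k
      averaged_payoff k i tt * ((W x == k)%:R * s (X x) i)); last first.
    apply/funext => x; apply: eq_bigr => i _.
    rewrite (bigD1 tt)//= big1 ?addr0; last by case.
    have [_] := my x; rewrite (bigD1 tt)//= big1 ?addr0; last by case.
    move=> ->; rewrite mulr1 (pick (fun k => averaged_payoff k i tt)) mulr_sumr.
    by apply: eq_bigr => k _; ring.
  have b1 i k : bdd (fun x => (W x == k)%:R * s (X x) i).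
    exact: bddM (bdd_state k) (bs i).
  have b2 i k :
      bdd (fun x => averaged_payoff k i tt * ((W x == k)%:R * s (X x) i)).
    exact: bddM (bdd_cst _) (b1 i k).
  rewrite dexpectation_sum//; last by move=> i; exact: bdd_sum.
  apply: eq_bigr => i _; rewrite dexpectation_sum//; apply: eq_bigr => k _.
  rewrite dexpectationZ// mulr_suml; apply: eq_bigr => j _; ring.
rewrite (_ : (fun x => stage_payoff g _ _ _) = fun x => \sum_i \sum_k \sum_j
    g k i j * ((W x == k)%:R * (s (X x) i * t (Y x) j))); last first.
  apply/funext => x; apply: eq_bigr => i _; rewrite exchange_big/=.
  apply: eq_bigr => j _; rewrite (pick (fun k => g k i j)) mulr_sumr.
  by apply: eq_bigr => k _; ring.
have b1 i k j : bdd (fun x => (W x == k)%:R * (s (X x) i * t (Y x) j)).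
  exact: bddM (bdd_state k) (bddM (bs i) (bt j)).
have b2 i k j :
    bdd (fun x => g k i j * ((W x == k)%:R * (s (X x) i * t (Y x) j))).
  exact: bddM (bdd_cst _) (b1 i k j).
rewrite dexpectation_sum//; last first.
  by move=> i; apply: bdd_sum => k; exact: bdd_sum.
apply: eq_bigr => i _; rewrite dexpectation_sum//; last first.
  by move=> k; exact: bdd_sum.
apply: eq_bigr => k _; rewrite dexpectation_sum//; apply: eq_bigr => j _.
rewrite dexpectationZ//; congr (_ * _); symmetry.
apply: (cond_indep_dexpectation k mu ci
  (s := fun a => s a i) (t := fun b => t b j)).
- by apply: bdd_le01 => a; exact: mixed_le1.
- by move=> a; case: (ms a).
- by apply: bdd_le01 => b; exact: mixed_le1.
- by move=> b; case: (mt b).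
Qed.

End averaging.

(** * The value-based distance *)

(** This needs the set of value differences to be bounded, which holds as
    values lie between -1 and 1. *)
Lemma value_dist_ge {R : realType} {K : finType} {S1 S2 T1 T2 : countType}
    (u : K * S1 * S2 -> R) (v : K * T1 * T2 -> R) {I J : finType}
    (g : K -> I -> J -> R) : is_distr u -> is_distr v -> is_payoff g ->
  `|game_value u g - game_value v g| <= value_dist u v.
Proof.
move=> du dv pg; apply: ub_le_sup; last by exists I, J, g.
exists 2 => _ [I' [J' [g' [pg' ->]]]].
rewrite (le_trans (ler_normB _ _))// -[2]/(1 + 1) lerD// ?game_value_le1//.
Qed.

Lemma value_dist_le {R : realType} {K : finType} {S1 S2 T1 T2 : countType}
    (u : K * S1 * S2 -> R) (v : K * T1 * T2 -> R) (r : R) :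
  (forall (I J : finType) (g : K -> I -> J -> R), is_payoff g ->
    `|game_value u g - game_value v g| <= r) -> value_dist u v <= r.
Proof.
move=> H; apply: ge_sup; last by move=> _ [I [J [g [pg ->]]]]; exact: H.
exists `|game_value u (fun _ (_ _ : unit) => 0) -
         game_value v (fun _ (_ _ : unit) => 0)|.
exists unit, unit, (fun _ _ _ => 0); split=> //.
split; rewrite ?card_unit// => _ _ _.
by rewrite oppr_le0 !ler01.
Qed.

Theorem proposition12 (R : realType) (K : finType) (hK : (2 <= #|K|)%N)
    (C C1 D D1 : countType) (u : K * (C * C1) * (D * D1) -> R)
    (hu : is_distr u)
    (hindep : cond_indep u
       (fun x => let: (k, (c, c1), (d, d1)) := x in (c, c1))
       (fun x => let: (k, (c, c1), (d, d1)) := x in d)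
       (fun x => let: (k, (c, c1), (d, d1)) := x in k)) :
  let v : K * C * (D * D1) -> R :=
    law u (fun x => let: (k, (c, c1), (d, d1)) := x in (k, c, (d, d1))) in
  let u' : K * (C * C1) * D -> R :=
    law u (fun x => let: (k, (c, c1), (d, d1)) := x in (k, (c, c1), d)) in
  let v' : K * C * D -> R :=
    law u (fun x => let: (k, (c, c1), (d, d1)) := x in (k, c, d)) in
  value_dist u' v' <= value_dist u v.
Proof.
pose v : K * C * (D * D1) -> R :=
  law u (fun x => let: (k, (c, c1), (d, d1)) := x in (k, c, (d, d1))).
pose u' : K * (C * C1) * D -> R :=
  law u (fun x => let: (k, (c, c1), (d, d1)) := x in (k, (c, c1), d)).
pose v' : K * C * D -> R :=
  law u (fun x => let: (k, (c, c1), (d, d1)) := x in (k, c, d)).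
change (value_dist u' v' <= value_dist u v).
have dv : is_distr v by exact: law_distr.
have du' : is_distr u' by exact: law_distr.
have dv' : is_distr v' by exact: law_distr.
pose W (x : K * (C * C1) * (D * D1)) := x.1.1.
pose X (x : K * (C * C1) * (D * D1)) := x.1.2.
pose Y (x : K * (C * C1) * (D * D1)) := x.2.1.
have ci : cond_indep u X Y W.
  have -> : X = fun x => let: (k, (c, c1), (d, d1)) := x in (c, c1).
    by apply/funext => -[[k [c c1]] [d d1]].
  have -> : Y = fun x => let: (k, (c, c1), (d, d1)) := x in d.
    by apply/funext => -[[k [c c1]] [d d1]].
  have -> // : W = fun x => let: (k, (c, c1), (d, d1)) := x in k.
  by apply/funext => -[[k [c c1]] [d d1]].
apply: value_dist_le => I J g pg.
have u'E s t : strategy (C * C1)%type I s -> strategy D J t -> payoff u' g s t =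
    dexpectation u (fun x => stage_payoff g (W x) (s (X x)) (t (Y x))).
  move=> ms mt; rewrite payoff_law//; congr dexpectation.
  by apply/funext => -[[k [c c1]] [d d1]].
have v'E s t : strategy C I s -> strategy D J t -> payoff v' g s t =
    dexpectation u (fun x => stage_payoff g (W x) (s (X x).1) (t (Y x))).
  move=> ms mt; rewrite payoff_law//; congr dexpectation.
  by apply/funext => -[[k [c c1]] [d d1]].
(* In [u'] player 1 can ignore c1 and play as in [v']. *)
have v'_le_u' : game_value v' g <= game_value u' g.
  apply/ler_addgt0Pr => e e0.
  have [s [_ [ms _ opt _]]] := game_value_optimal dv' pg e0.
  rewrite -lerBlDr.
  apply: (game_value_ge du' pg (s := fun a => s a.1)) => [a|t mt].
    exact: ms.
  by rewrite u'E// -?v'E//; exact: opt.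
rewrite ger0_norm ?subr_ge0//; apply/ler_addgt0Pr => e e0.
have e20 : 0 < e / 2 by rewrite divr_gt0.
have [_ [t [_ mt _ topt]]] := game_value_optimal dv' pg e20.
have [s [_ [ms _ sopt _]]] := game_value_optimal du' pg e20.
pose h := averaged_payoff u Y W g t.
have ph : is_payoff h by exact: averaged_is_payoff.
have dist_ge := le_trans (ler_norm _) (value_dist_ge hu dv ph).
have uh : game_value u' g - e / 2 <= game_value u h.
  apply: (game_value_ge hu ph ms) => y my.
  rewrite payoffE (averaged_payoffE g hu ci mt ms (fun x => my _)) -u'E//.
  exact: sopt.
pose y1 (_ : D * D1) (_ : unit) : R := 1.
have my1 : strategy (D * D1)%type unit y1.
  move=> b; split=> [i|]; first exact: ler01.
  by rewrite /y1 sumr_const card_unit.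
have vh : game_value v h <= game_value v' g + e / 2.
  apply: (game_value_le dv ph my1) => r mr.
  apply: le_trans (topt r mr); rewrite v'E//.
  rewrite -(averaged_payoffE g hu ci mt (s := fun a => r a.1) (fun a => mr a.1)
     (y := fun x => y1 x.2) (fun x => my1 _)).
  rewrite payoff_law// le_eqVlt; apply/orP; left; apply/eqP.
  by congr dexpectation; apply/funext => -[[k [c c1]] [d d1]].
by move: uh vh dist_ge; lra.
Qed.
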